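(* Let $\mathcal{P}$ be a PTRS that is orthogonal and right-linear (equivalently, non-overlapping and linear). Then $\mathrm{edc}_{\xrightarrow{\mathbf{f}}_{\mathcal{P}}}=\mathrm{edc}_{\xrightarrow{\mathbf{i}}_{\mathcal{P}}}$ and $\mathrm{erc}_{\xrightarrow{\mathbf{f}}_{\mathcal{P}}}=\mathrm{erc}_{\xrightarrow{\mathbf{i}}_{\mathcal{P}}}$ (as functions $\mathbb{N}\to\mathbb{N}\cup\{\omega\}$).
   Context: Terms $\mathcal{T}$ over a countable signature $\Sigma$ and countable variables $\mathcal{V}$. A finite multi-distribution on $A\ne\emptyset$: finite multiset of pairs $(p:a)$, $0<p\le1$, probabilities summing to 1; $\mathrm{FDist}(A)$, $\mathrm{Supp}(\mu)$, $p\cdot\mu$ as usual. A PTRS is a countable set $\mathcal{P}$ of rules $\ell\to\mu$, $\ell\notin\mathcal{V}$, $\mu\in\mathrm{FDist}(\mathcal{T})$, $\mathcal{V}(r)\subseteq\mathcal{V}(\ell)$ for $r\in\mathrm{Supp}(\mu)$. $s\xrightarrow{\mathbf{f}}_{\mathcal{P}}\{p_1:t_1,\dots,p_k:t_k\}$ iff $s|_\pi=\ell\sigma$ and $t_j=s[r_j\sigma]_\pi$ for some position $\pi$, rule $\ell\to\{p_1:r_1,\dots,p_k:r_k\}\in\mathcal{P}$, substitution $\sigma$; innermost ($\xrightarrow{\mathbf{i}}_{\mathcal{P}}$) if all proper subterms of $\ell\sigma$ are normal forms (terms admitting no step). Lifting $\rightrightarrows$ of $\to$: smallest relation on $\mathrm{FDist}(\mathcal{T})$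 with $\{1:t\}\rightrightarrows\{1:t\}$ for normal forms, $\{1:t\}\rightrightarrows\mu$ if $t\to\mu$, and $\bigcup_jp_j\cdot\mu_j\rightrightarrows\bigcup_jp_j\cdot\nu_j$ if $\mu_j\rightrightarrows\nu_j$, $\sum p_j=1$. $|\mu|_\to$: total probability of normal forms in $\mu$. $\mathrm{edl}((\mu_n))=\sum_{n\ge0}(1-|\mu_n|_\to)$; $\mathrm{edh}_\to(t)=\sup\{\mathrm{edl}(\vec\mu)\mid\vec\mu$ infinite $\rightrightarrows$-sequence, $\mu_0=\{1:t\}\}$. Term size: $|x|=1$, $|f(t_1,\dots,t_k)|=1+\sum|t_i|$. Expected derivational complexity: $\mathrm{edc}_\to(n)=\sup\{\mathrm{edh}_\to(t)\mid t\in\mathcal{T},|t|\le n\}$. Defined symbols of $\mathcal{P}$ are root symbols of left-hand sides; all other symbols are constructors; a term is basic if it is $f(t_1,\dots,t_k)$ with $f$ defined and each $t_i$ built only from constructors and variables. Expected runtime complexity: $\mathrm{erc}_\to(n)=\sup\{\mathrm{edh}_\to(t)\mid t$ basic$,|t|\le n\}$ (with $\sup\emptyset=0$). Non-overlapping: no two rules (renamed apart) and non-variable position $\pi$ of the first left-hand side $\ell_1$ with $\ell_1|_\pi$ unifiable with the second left-hand side ($\pi\ne\varepsilon$ if the same rule). Left-/right-linear: no variable occurs twice in a left-hand side / in any $r\in\mathrm{Supp}(\mu)$. Orthogonal: non-overlapping and left-linear. *)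

(* Defs.v *)
From HB Require Import structures.
From mathcomp Require Import all_boot all_order all_algebra.
From mathcomp Require Import finmap multiset.
From mathcomp Require Import all_classical all_reals all_analysis.

Set Implicit Arguments.
Unset Strict Implicit.
Unset Printing Implicit Defensive.

Import Order.TTheory GRing.Theory Num.Theory.

Local Open Scope classical_set_scope.
Local Open Scope ring_scope.

Section FDist.
Variables (R : realType) (A : choiceType).

Definition is_fdist (mu : {mset (R * A)}%mset) : bool :=
  all (fun x : R * A => 0 < x.1 <= 1) mu && (\sum_(x <- mu) x.1 == 1).

Record fdist := FDist { fdist_mset :> {mset (R * A)}%mset ; _ : is_fdist fdist_mset }.

Definition fdist_supp (mu : fdist) : set A := [set a | exists p : R, (p, a) \in (mu : seq _)].

Lemma dirac_is_fdist (a : A) : is_fdist [mset (1 : R, a)]%mset.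
Proof. by rewrite /is_fdist enum_msetn /= big_seq1 ltr01 lexx eqxx. Qed.

Definition fdirac (a : A) : fdist := FDist (dirac_is_fdist a).

Definition mset_scale (p : R) (mu : {mset (R * A)}%mset) : {mset (R * A)}%mset :=
  seq_mset [seq (p * x.1, x.2) | x <- mu].

(* The union of multi-distributions adds multiplicities: it is msetD, whereas
   msetU takes the maximum of the multiplicities. *)
Definition mset_mix (k : nat) (p : 'I_k -> R) (mu : 'I_k -> fdist) : {mset (R * A)}%mset :=
  \big[(@msetD _)/(@mset0 _)]_(j < k) mset_scale (p j) (mu j).

End FDist.

Definition mset_map (R : realType) (A B : choiceType) (f : A -> B)
    (mu : {mset (R * A)}%mset) : {mset (R * B)}%mset :=
  seq_mset [seq (x.1, f x.2) | x <- mu].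

Section ExpectedDerivation.
Variables (R : realType) (A : choiceType) (step : A -> fdist R A -> Prop).

Definition normal_form (t : A) : Prop := ~ exists mu, step t mu.

Inductive lifting : fdist R A -> fdist R A -> Prop :=
| lifting_nf (t : A) : normal_form t -> lifting (fdirac R t) (fdirac R t)
| lifting_step (t : A) (mu : fdist R A) : step t mu -> lifting (fdirac R t) mu
| lifting_mix (k : nat) (p : 'I_k -> R) (mu nu : 'I_k -> fdist R A) (mu' nu' : fdist R A) :
    (forall j, 0 < p j) -> \sum_(j < k) p j = 1 ->
    (forall j, lifting (mu j) (nu j)) ->
    fdist_mset mu' = mset_mix p mu -> fdist_mset nu' = mset_mix p nu ->
    lifting mu' nu'.

Definition nf_prob (mu : fdist R A) : R :=
  \sum_(x <- (mu : seq _) | `[< normal_form x.2 >]) x.1.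

Definition edl (mu : nat -> fdist R A) : \bar R :=
  (\sum_(0 <= n <oo) (1 - nf_prob (mu n))%:E)%E.

(* Supremum in [0, +oo]; in particular the supremum of the empty set is 0,
   unlike ereal_sup set0 = -oo. *)
Definition sup_nneg (X : set (\bar R)) : \bar R := ereal_sup (0%E |` X).

Definition edh (t : A) : \bar R :=
  sup_nneg [set edl mu | mu in
    [set mu : nat -> fdist R A | mu 0%N = fdirac R t /\ forall n, lifting (mu n) (mu n.+1)]].

End ExpectedDerivation.

Record signature := Signature { sym :> countType ; arity : sym -> nat }.

Inductive term (S : signature) (V : Type) : Type :=
| Var (x : V)
| App (f : S) (args : 'I_(arity f) -> term S V).

Arguments Var {S V} x.
Arguments App {S V} f args.

HB.instance Definition _ (S : signature) (V : Type) := gen_eqMixin (term S V).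
HB.instance Definition _ (S : signature) (V : Type) := gen_choiceMixin (term S V).

Section Terms.
Variables (S : signature) (V : Type).

Fixpoint term_size (t : term S V) : nat :=
  match t with
  | Var _ => 1
  | App f args => (1 + \sum_(i < arity f) term_size (args i))%N
  end.

Definition is_var (t : term S V) : bool := if t is Var _ then true else false.

(* Positions are sequences of argument indices, counted from 0. *)
Fixpoint subterm_at (t : term S V) (pi : seq nat) : option (term S V) :=
  match pi, t with
  | [::], _ => Some t
  | i :: pi', App f args =>
      if insub i is Some j then subterm_at (args j) pi' else None
  | _ :: _, Var _ => None
  end.

Fixpoint replace_at (t : term S V) (pi : seq nat) (u : term S V) : term S V :=
  match pi, t with
  | [::], _ => u
  | i :: pi', App f args =>
      App f (fun j => if (j : nat) == i then replace_at (args j) pi' u else args j)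
  | _ :: _, Var _ => t
  end.

Definition proper_subterm (u t : term S V) : Prop :=
  exists2 pi : seq nat, pi <> [::] & subterm_at t pi = Some u.

End Terms.

Section Substitution.
Variables (S : signature) (V W : Type).

Fixpoint subst (s : V -> term S W) (t : term S V) : term S W :=
  match t with
  | Var x => s x
  | App f args => App f (fun i => subst s (args i))
  end.

Definition rename (h : V -> W) : term S V -> term S W :=
  subst (fun x => Var (h x)).

End Substitution.

Definition unifiable (S : signature) (V : Type) (s t : term S V) : Prop :=
  exists sigma : V -> term S V, subst sigma s = subst sigma t.

Section Occurrences.
Variables (S : signature) (V : eqType).

Fixpoint nocc (x : V) (t : term S V) : nat :=
  match t with
  | Var y => (x == y)
  | App f args => (\sum_(i < arity f) nocc x (args i))%N
  end.

Definition vars (t : term S V) : set V := [set x | (0 < nocc x t)%N].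

Definition linear_term (t : term S V) : Prop :=
  forall x : V, (nocc x t <= 1)%N.

End Occurrences.

Section PTRS.
Variables (R : realType) (S : signature) (V : countType).

Record rule := Rule { lhs : term S V ; rhs : fdist R (term S V) }.

Record ptrs := Ptrs {
  rules : set rule ;
  rules_countable : countable rules ;
  rules_lhs : forall r, rules r -> ~~ is_var (lhs r) ;
  rules_vars : forall r, rules r ->
    forall t, fdist_supp (rhs r) t -> vars t `<=` vars (lhs r) }.

Variable P : ptrs.

Definition contracts (s : term S V) (pi : seq nat) (r : rule) (sigma : V -> term S V)
    (mu : fdist R (term S V)) : Prop :=
  subterm_at s pi = Some (subst sigma (lhs r)) /\
  fdist_mset mu = mset_map (fun t => replace_at s pi (subst sigma t)) (rhs r).

Definition full_step (s : term S V) (mu : fdist R (term S V)) : Prop :=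
  exists pi r sigma, rules P r /\ contracts s pi r sigma mu.

Definition innermost_step (s : term S V) (mu : fdist R (term S V)) : Prop :=
  exists pi r sigma, [/\ rules P r, contracts s pi r sigma mu &
    forall u, proper_subterm u (subst sigma (lhs r)) -> normal_form full_step u].

(* The two rules are renamed apart by moving their variables to the two
   summands of V + V. *)
Definition overlap (r1 r2 : rule) (pi : seq nat) : Prop :=
  exists u : term S V,
    [/\ subterm_at (lhs r1) pi = Some u, ~~ is_var u,
        r1 = r2 -> pi <> [::] &
        unifiable (rename (inl : V -> V + V) u) (rename (inr : V -> V + V) (lhs r2))].

Definition non_overlapping : Prop :=
  forall r1 r2 pi, rules P r1 -> rules P r2 -> ~ overlap r1 r2 pi.

Definition left_linear : Prop := forall r, rules P r -> linear_term (lhs r).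

Definition right_linear : Prop :=
  forall r, rules P r -> forall t, fdist_supp (rhs r) t -> linear_term t.

Definition orthogonal_ptrs : Prop := non_overlapping /\ left_linear.

Definition defined_symbol (f : S) : Prop :=
  exists r, rules P r /\ exists args, lhs r = App f args.

Fixpoint constructor_term (t : term S V) : Prop :=
  match t with
  | Var _ => True
  | App f args => ~ defined_symbol f /\ forall i, constructor_term (args i)
  end.

Definition basic (t : term S V) : Prop :=
  match t with
  | Var _ => False
  | App f args => defined_symbol f /\ forall i, constructor_term (args i)
  end.

End PTRS.

Section Complexity.
Variables (R : realType) (S : signature) (V : countType).

Definition edc (step : term S V -> fdist R (term S V) -> Prop) (n : nat) : \bar R :=
  sup_nneg [set edh step t | t in [set t : term S V | (term_size t <= n)%N]].

Definition erc (P : ptrs R S V) (step : term S V -> fdist R (term S V) -> Prop) (n : nat) :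
    \bar R :=
  sup_nneg [set edh step t | t in [set t : term S V | basic P t /\ (term_size t <= n)%N]].

End Complexity.

(* Main.v *)
Require Import Defs.
From mathcomp Require Import all_boot all_order all_algebra.
From mathcomp Require Import finmap multiset.
From mathcomp Require Import all_classical all_reals all_analysis.
From mathcomp Require Import zify.

(** Full and innermost steps have the same normal forms, and innermost steps are
    full, so only the bound of full derivations by innermost ones is at stake.
    An innermost redex is equal to, parallel to, or inside the substitution of
    any other redex; by orthogonality and right-linearity, contracting the
    latter leaves at most one copy of the former. Writing [W n u] for the
    greatest expected number of steps in the first [n] rounds of a full strategy
    started in [u], this diamond yields, by induction on [n],
      [W n u <= 1 + \sum_k q_k * W n u_k]
    for every innermost step [u -> {q_k : u_k}]. Iterating along an innermost
    derivation from [u] gives, for every [N],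
      [W n u <= (expected number of its steps before N) + n * P(alive at N)].
    If the derivation has finite expected length, the last probability tends to
    0, so [W n u] is at most that length. *)

Set Implicit Arguments.
Unset Strict Implicit.
Unset Printing Implicit Defensive.

Import Order.TTheory GRing.Theory Num.Theory.
Import numFieldNormedType.Exports.

Local Open Scope classical_set_scope.
Local Open Scope ring_scope.

(** * Finite multi-distributions *)

Section FDistTheory.
Variables (R : realType) (A : choiceType).
Implicit Types (m : {mset (R * A)}%mset) (mu nu : fdist R A) (F G : A -> R).

Definition expect m F : R := \sum_(x <- (m : seq _)) x.1 * F x.2.

Lemma fdist_inj : injective (@fdist_mset R A).
Proof.
move=> [m mP] [m' m'P] /= e; case: _ / e m'P => m'P.
by rewrite (bool_irrelevance mP m'P).
Qed.

Lemma is_fdistP m :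
  reflect ({in m, forall x, 0 < x.1} /\ expect m (fun=> 1) = 1) (is_fdist m).
Proof.
have -> : expect m (fun=> 1) = \sum_(x <- (m : seq _)) x.1.
  by apply: eq_bigr => x _; rewrite mulr1.
apply: (iffP andP) => [[/allP m01 /eqP m1]|[m0 m1]]; split; rewrite ?m1 //.
  by move=> x /m01 /andP[].
apply/allP => x xm; rewrite (m0 x xm) /= -m1 (big_rem x xm) /= lerDl big_seq.
by apply: sumr_ge0 => y /mem_rem ym; apply/ltW/m0.
Qed.

Lemma fdist_prob_gt0 mu : {in (mu : seq _), forall x, 0 < x.1}.
Proof. by case: mu => m /= /is_fdistP[]. Qed.

Lemma expect_seq_mset (s : seq (R * A)) F :
  expect (seq_mset s) F = \sum_(x <- s) x.1 * F x.2.
Proof. exact: perm_big (perm_eq_seq_mset s). Qed.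

Lemma expect_mset0 F : expect mset0 F = 0.
Proof. exact: big_mset0. Qed.

Lemma expect_msetD m m' F : expect (m `+` m')%mset F = expect m F + expect m' F.
Proof.
rewrite /expect -big_cat; apply: perm_big; apply/allP => x _ /=.
by rewrite count_cat !count_mem_mset msetE2.
Qed.

Lemma expect_mset_scale p m F : expect (mset_scale p m) F = p * expect m F.
Proof.
rewrite expect_seq_mset big_map big_distrr /=.
by apply: eq_bigr => x _; rewrite mulrA.
Qed.

Lemma expect_mset_mix k (p : 'I_k -> R) (mu : 'I_k -> fdist R A) F :
  expect (mset_mix p mu) F = \sum_(j < k) p j * expect (mu j) F.
Proof.
rewrite /mset_mix; elim/big_rec2: _ => [|j x m _ <-]; first exact: expect_mset0.
by rewrite expect_msetD expect_mset_scale.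
Qed.

Lemma expect_fdirac a F : expect (fdirac R a) F = F a.
Proof. by rewrite /expect /= enum_msetn big_seq1 mul1r. Qed.

Lemma expectD m F G : expect m (fun a => F a + G a) = expect m F + expect m G.
Proof.
by rewrite /expect -big_split; apply: eq_bigr => x _; rewrite mulrDr.
Qed.

Lemma expectZ m c F : expect m (fun a => c * F a) = c * expect m F.
Proof.
by rewrite /expect big_distrr; apply: eq_bigr => x _ /=; rewrite mulrCA.
Qed.

Lemma expectN m F : expect m (fun a => - F a) = - expect m F.
Proof. by rewrite /expect -sumrN; apply: eq_bigr => x _; rewrite mulrN. Qed.

Lemma expectB m F G : expect m (fun a => F a - G a) = expect m F - expect m G.
Proof. by rewrite expectD expectN. Qed.

Lemma expect_cst mu c : expect mu (fun=> c) = c.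
Proof.
rewrite -[c]mulr1 expectZ.
by case: mu => m /= /is_fdistP[_ ->]; rewrite mulr1.
Qed.

Lemma le_expect mu F G :
  (forall a, fdist_supp mu a -> F a <= G a) -> expect mu F <= expect mu G.
Proof.
move=> FG; rewrite /expect !big_seq; apply: ler_sum => x xmu.
apply: ler_wpM2l; first exact/ltW/fdist_prob_gt0/xmu.
by apply: FG; exists x.1; rewrite -surjective_pairing.
Qed.

Lemma expect_ge0 mu F : (forall a, 0 <= F a) -> 0 <= expect mu F.
Proof. by move=> F0; rewrite -(expect_cst mu 0); apply: le_expect. Qed.

Lemma is_fdist_mset_mix k (p : 'I_k -> R) (mu : 'I_k -> fdist R A) :
  (forall j, 0 < p j) -> \sum_(j < k) p j = 1 -> is_fdist (mset_mix p mu).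
Proof.
move=> p0 p1; apply/is_fdistP; split; last first.
  by rewrite expect_mset_mix; under eq_bigr do rewrite expect_cst mulr1.
rewrite /mset_mix; elim/big_ind: _ => [x|m m' IH IH' x|j _ x].
- by rewrite in_mset0.
- by rewrite in_msetD => /orP[/IH|/IH'].
- rewrite (perm_mem (perm_eq_seq_mset _)) => /mapP[y ymu ->] /=.
  by rewrite mulr_gt0 //; exact: fdist_prob_gt0 ymu.
Qed.

Lemma fdist_mix_fdirac mu (atom := tnth (in_tuple mu)) :
  fdist_mset mu =
  mset_mix (fun j => (atom j).1) (fun j => fdirac R (atom j).2).
Proof.
have scale_fdirac (x : R * A) : mset_scale x.1 (fdirac R x.2) = [mset x]%mset.
  rewrite /mset_scale /= enum_msetn /= mulr1 -surjective_pairing.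
  by apply/msetP => y; rewrite mset_seqE /= addn0 msetnE eq_sym; case: eqP.
rewrite /mset_mix; under eq_bigr do rewrite scale_fdirac.
rewrite -(big_tnth _ _ mu xpredT (fun x => [mset x]%mset)).
rewrite -[LHS]seq_mset_id; elim: (mu : seq _) => [|x s IH].
  by rewrite big_nil; apply/msetP => x; rewrite mset_seqE mset0E.
by rewrite big_cons -IH mset_cons.
Qed.

End FDistTheory.

Section FDistMap.
Variables (R : realType) (A B : choiceType).
Implicit Types (f g : A -> B) (mu : fdist R A).

Lemma expect_mset_map f (m : {mset (R * A)}%mset) (F : B -> R) :
  expect (mset_map f m) F = expect m (F \o f).
Proof. by rewrite expect_seq_mset big_map. Qed.

Lemma is_fdist_mset_map f mu : is_fdist (mset_map f mu).
Proof.
apply/is_fdistP; split; last by rewrite expect_mset_map expect_cst.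
move=> x; rewrite (perm_mem (perm_eq_seq_mset _)) => /mapP[y ymu ->] /=.
exact: fdist_prob_gt0 ymu.
Qed.

Definition fdist_map f mu : fdist R B := FDist (is_fdist_mset_map f mu).

Lemma eq_fdist_map f g mu :
  (forall a, fdist_supp mu a -> f a = g a) -> fdist_map f mu = fdist_map g mu.
Proof.
move=> fg; apply: fdist_inj; congr seq_mset; apply/eq_in_map => x xmu.
by rewrite fg //; exists x.1; rewrite -surjective_pairing.
Qed.

Lemma exchange_expect (m : {mset (R * A)}%mset) (m' : {mset (R * B)}%mset)
    (F : A -> B -> R) :
  expect m (fun a => expect m' (F a)) = expect m' (fun b => expect m (F^~ b)).
Proof.
rewrite /expect; under eq_bigr do rewrite big_distrr /=.
under [RHS]eq_bigr do rewrite big_distrr /=.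
rewrite exchange_big; apply: eq_bigr => y _; apply: eq_bigr => x _.
exact: mulrCA.
Qed.

End FDistMap.

(** * Expected derivation length *)

Section NonnegativeSeries.
Variables (R : realType) (u : nat -> R).
Hypothesis u_ge0 : forall n, 0 <= u n.

Lemma nneseries_le (x : \bar R) :
  (forall n, ((series u n)%:E <= x)%E) -> (\sum_(0 <= k <oo) (u k)%:E <= x)%E.
Proof.
move=> ux; apply: lime_le.
  by apply: is_cvg_nneseries => n _ _; rewrite lee_fin.
by apply: nearW => n; rewrite sumEFin; exact: ux.
Qed.

(* If the sum is finite, then [u n] vanishes in the limit. *)
Lemma nneseries_ge_series_term (x c : R) :
  (forall n, x <= series u n + c * u n) ->
  (x%:E <= \sum_(0 <= k <oo) (u k)%:E)%E.
Proof.
move=> xu; have [->|] := eqVneq (\sum_(0 <= k <oo) (u k)%:E)%E +oo%E.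
  exact: leey.
rewrite -ltey => /(nnseries_is_cvg u_ge0) u_summable.
apply: (@le_trans _ _ (limn (series u))%:E).
  have cu0 : c * u n @[n --> \oo] --> c * 0.
    exact: cvgM (cvg_cst c) (cvg_series_cvg_0 u_summable).
  rewrite lee_fin -[limn _]addr0 -(mulr0 c).
  by apply: cvgr_to_ge (cvgD u_summable cu0) _; apply: nearW => n; exact: xu.
by rewrite -EFin_lim //; under eq_fun do rewrite sumEFin.
Qed.

End NonnegativeSeries.

Section Derivations.
Variables (R : realType) (A : choiceType) (step : A -> fdist R A -> Prop).
Implicit Types (a : A) (mu nu : fdist R A) (F G W : A -> R).

Definition lifting_sequence (mus : nat -> fdist R A) : Prop :=
  forall n, lifting step (mus n) (mus n.+1).

Definition derivation a mus : Prop :=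
  mus 0%N = fdirac R a /\ lifting_sequence mus.

Definition live_prob (mus : nat -> fdist R A) n : R :=
  1 - nf_prob step (mus n).

Definition reducible a : R := (~~ `[< normal_form step a >])%:R.

Lemma reducible_nf a : normal_form step a -> reducible a = 0.
Proof. by move=> nf; rewrite /reducible asboolT. Qed.

Lemma reducible_step a mu : step a mu -> reducible a = 1.
Proof. by move=> s; rewrite /reducible asboolF // => -[]; exists mu. Qed.

Lemma live_probE mus n : live_prob mus n = expect (mus n) reducible.
Proof.
apply/eqP; rewrite subr_eq -[eqbLHS](expect_cst (mus n) 1); apply/eqP.
rewrite /nf_prob /expect [X in _ + X]big_mkcond -big_split.
apply: eq_bigr => x _ /=; rewrite /reducible.
by case: ifP; rewrite ?(mulr0, mulr1, add0r, addr0).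
Qed.

Lemma live_prob_ge0 mus n : 0 <= live_prob mus n.
Proof. by rewrite live_probE expect_ge0 // => a; exact: ler0n. Qed.

Lemma edlE mus : edl step mus = (\sum_(0 <= n <oo) (live_prob mus n)%:E)%E.
Proof. by []. Qed.

Lemma lifting_exists mu : exists nu, lifting step mu nu.
Proof.
have fdirac_lifting a : exists nu, lifting step (fdirac R a) nu.
  have [nf|/contrapT[nu s]] := pselect (normal_form step a).
    by exists (fdirac R a); exact: lifting_nf.
  by exists nu; exact: lifting_step.
have [next nextP] := choice fdirac_lifting.
pose atom := tnth (in_tuple mu).
have p_gt0 j : 0 < (atom j).1 by apply: fdist_prob_gt0; exact: mem_tnth.
have p_sum : \sum_j (atom j).1 = 1.
  rewrite -(big_tnth _ _ mu xpredT fst) -[RHS](expect_cst mu 1).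
  by apply: eq_bigr => x _; rewrite mulr1.
exists (FDist (is_fdist_mset_mix (fun j => next (atom j).2) p_gt0 p_sum)).
apply: (lifting_mix p_gt0 p_sum (fun j => nextP (atom j).2)) => //.
exact: fdist_mix_fdirac.
Qed.

Lemma derivation_exists a : exists mus, derivation a mus.
Proof.
have [next nextP] := choice lifting_exists.
by exists (fun n => iter n next (fdirac R a)); split => // n; exact: nextP.
Qed.

Lemma edl_le_edh a mus : derivation a mus -> (edl step mus <= edh step a)%E.
Proof. by move=> d; apply: ereal_sup_ubound; right; exists mus. Qed.

Lemma edh_le a (x : \bar R) : (0 <= x)%E ->
  (forall mus, derivation a mus -> (edl step mus <= x)%E) ->
  (edh step a <= x)%E.
Proof. by move=> x0 dx; apply: ge_ereal_sup => _ [->|[mus /dx ? <-]]. Qed.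

Lemma edh_ge0 a : (0 <= edh step a)%E.
Proof. by apply: ereal_sup_ubound; left. Qed.

Lemma lifting_expect_le F G mu nu :
  (forall a, normal_form step a -> F a <= G a) ->
  (forall a rho, step a rho -> expect rho F <= G a) ->
  lifting step mu nu -> expect nu F <= expect mu G.
Proof.
move=> nfFG stepFG.
elim=> {mu nu} [a nf|a rho s|k p mu nu mu' nu' p_gt0 _ _ IH -> ->].
- by rewrite !expect_fdirac; exact: nfFG.
- by rewrite expect_fdirac; exact: stepFG.
- by rewrite !expect_mset_mix; apply: ler_sum => j _; rewrite ler_pM2l.
Qed.

Lemma lifting_expect_ge F G mu nu :
  (forall a, normal_form step a -> G a <= F a) ->
  (forall a rho, step a rho -> G a <= expect rho F) ->
  lifting step mu nu -> expect mu G <= expect nu F.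
Proof.
move=> nfGF stepGF /(@lifting_expect_le (fun a => - F a) (fun a => - G a)).
rewrite !expectN lerN2; apply=> [a /nfGF|a rho /stepGF]; first by rewrite lerN2.
by rewrite expectN lerN2.
Qed.

Definition payoffs W a : set R := 0 |` [set 1 + expect mu W | mu in step a].

(* The greatest expected number of steps within the first [n] rounds of a
   strategy started in [a]. *)
Fixpoint max_steps n a : R :=
  if n is n'.+1 then sup (payoffs (max_steps n') a) else 0.

Lemma ubound_payoffs W (c : R) a : 0 <= c -> (forall b, W b <= c) ->
  ubound (payoffs W a) (1 + c).
Proof.
move=> c0 Wc _ [->|[mu _ <-]]; first by rewrite addr_ge0.
by rewrite lerD2l -(expect_cst mu c); apply: le_expect.
Qed.

Lemma max_steps_le n a : max_steps n a <= n%:R.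
Proof.
elim: n a => [|n IH] a //=; rewrite -natr1 addrC.
by apply: ge_sup; [exists 0; left | exact: ubound_payoffs].
Qed.

Lemma has_ubound_payoffs n a : has_ubound (payoffs (max_steps n) a).
Proof.
by exists (1 + n%:R); apply: ubound_payoffs => // b; exact: max_steps_le.
Qed.

Lemma max_steps_ge0 n a : 0 <= max_steps n a.
Proof.
case: n => [|n] //=.
by apply: ub_le_sup; [exact: has_ubound_payoffs | left].
Qed.

Lemma max_stepsS_ge n a mu : step a mu ->
  1 + expect mu (max_steps n) <= max_steps n.+1 a.
Proof.
by move=> s; apply: ub_le_sup; [exact: has_ubound_payoffs | right; exists mu].
Qed.

Lemma max_stepsS_le n a x : 0 <= x ->
  (forall mu, step a mu -> 1 + expect mu (max_steps n) <= x) ->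
  max_steps n.+1 a <= x.
Proof.
move=> x0 stepx; apply: ge_sup; first by exists 0; left.
by move=> _ [->|[mu s <-]] //; exact: stepx.
Qed.

Lemma max_steps_leS n a : max_steps n a <= max_steps n.+1 a.
Proof.
elim: n a => [|n IH] a; first exact: max_steps_ge0.
apply: max_stepsS_le => [|mu s]; first exact: max_steps_ge0.
apply: le_trans (max_stepsS_ge n.+1 s).
by rewrite lerD2l; apply: le_expect.
Qed.

Lemma max_steps_nf n a : normal_form step a -> max_steps n a = 0.
Proof.
move=> nf; apply/eqP; rewrite eq_le max_steps_ge0 andbT.
case: n => [//|n]; apply: max_stepsS_le => // mu s.
by case: nf; exists mu.
Qed.

Lemma max_steps_le_reducible n a : max_steps n a <= n%:R * reducible a.
Proof.
have [nf|/contrapT[mu s]] := pselect (normal_form step a).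
  by rewrite max_steps_nf // reducible_nf // mulr0.
by rewrite (reducible_step s) mulr1 max_steps_le.
Qed.

Lemma series_live_prob_le_max_steps mus n :
  lifting_sequence mus ->
  series (live_prob mus) n <= expect (mus 0%N) (max_steps n).
Proof.
elim: n mus => [|n IH] mus lift.
  by rewrite /series /= big_geq // expect_ge0 // => a; exact: max_steps_ge0.
rewrite /series [leLHS]/= big_nat_recl // live_probE -lerBrDl -expectB.
apply: le_trans (IH (fun k => mus k.+1) (fun k => lift k.+1)) _.
apply: lifting_expect_le (lift 0%N) => [a nf|a rho s].
  by rewrite !max_steps_nf // reducible_nf // subr0.
by rewrite (reducible_step s) lerBrDl max_stepsS_ge.
Qed.

End Derivations.

(** * Relations with a diamond property *)

Section Diamond.
Variables (R : realType) (A : choiceType) (step step' : A -> fdist R A -> Prop).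
Implicit Types (a : A) (mu nu : fdist R A).

(* Two steps close a diamond if they coincide or if a grid [h b c] of common
   reducts completes them. A [step] may erase the [step']-redex, but a [step']
   may neither erase nor duplicate the [step]-redex. *)
Variant joinable : fdist R A -> fdist R A -> Prop :=
| joinable_refl mu : joinable mu mu
| joinable_grid (B C : choiceType) (rho : fdist R B) (sigma : fdist R C)
    (f : B -> A) (g : C -> A) (h : B -> C -> A) :
    (forall b, fdist_supp rho b ->
      step' (f b) (fdist_map (h b) sigma) \/ forall c, h b c = f b) ->
    (forall c, fdist_supp sigma c -> step (g c) (fdist_map (h^~ c) rho)) ->
    joinable (fdist_map f rho) (fdist_map g sigma).

Definition diamond : Prop :=
  forall a mu nu, step a mu -> step' a nu -> joinable mu nu.

Lemma diamond_max_steps_le n a nu : diamond -> step' a nu ->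
  max_steps step n a <= 1 + expect nu (max_steps step n).
Proof.
move=> dia; elim: n a nu => [|n IH] a nu s'.
  by rewrite addr_ge0 // expect_ge0 // => b; exact: max_steps_ge0.
apply: max_stepsS_le => [|mu s].
  by rewrite addr_ge0 // expect_ge0 // => b; exact: max_steps_ge0.
rewrite lerD2l; case: (dia _ _ _ s s') => {a mu nu s s'}
  [mu|B C rho sigma f g h fh gh].
  by apply: le_expect => b _; exact: max_steps_leS.
have f_le b : fdist_supp rho b ->
    max_steps step n (f b) <= 1 + expect sigma (max_steps step n \o h b).
  case/fh=> [/IH|hf]; first by rewrite expect_mset_map.
  rewrite (_ : _ \o _ = fun=> max_steps step n (f b)) ?expect_cst ?lerDr //.
  by apply/funext => c /=; rewrite hf.
rewrite !expect_mset_map; apply: le_trans (le_expect f_le) _.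
rewrite expectD expect_cst exchange_expect.
rewrite -[X in X + _](expect_cst sigma) -expectD.
apply: le_expect => c /gh /(@max_stepsS_ge _ _ _ n).
by rewrite expect_mset_map.
Qed.

Hypothesis step'_step : forall a mu, step' a mu -> step a mu.
Hypothesis nf'_nf : forall a, normal_form step' a -> normal_form step a.

Let normal_form_iff a : normal_form step a <-> normal_form step' a.
Proof. by split=> [nf [mu /step'_step s]|/nf'_nf //]; apply: nf; exists mu. Qed.

Lemma live_prob_eq mus : live_prob step mus = live_prob step' mus.
Proof.
apply/funext => n; congr (1 - _).
by apply: eq_bigl => x; apply/asboolP/asboolP => /normal_form_iff.
Qed.

Lemma lifting_sub mu nu : lifting step' mu nu -> lifting step mu nu.
Proof.
elim=> {mu nu} [a nf|a mu s|k p mu nu mu' nu' p_gt0 p_sum _ IH e e'].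
- exact: lifting_nf (nf'_nf nf).
- exact: lifting_step (step'_step s).
- exact: lifting_mix p_gt0 p_sum IH e e'.
Qed.

Lemma edh_sub a : (edh step' a <= edh step a)%E.
Proof.
apply: edh_le (edh_ge0 _ _) _ => mus [mus0 lift].
rewrite edlE -live_prob_eq -edlE.
by apply: edl_le_edh; split=> // n; exact: lifting_sub.
Qed.

Hypothesis step_diamond : diamond.

Lemma max_steps_le_series_live_prob mus n N :
  lifting_sequence step' mus ->
  expect (mus 0%N) (max_steps step n) <=
  series (live_prob step' mus) N + expect (mus N) (max_steps step n).
Proof.
move=> lift; elim: N => [|N IH]; first by rewrite /series /= big_geq // add0r.
apply: le_trans IH _; rewrite seriesSr -addrA lerD2l -live_prob_eq live_probE.
rewrite -lerBlDl -expectB.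
apply: lifting_expect_ge (lift N) => [a /nf'_nf nf|a rho s].
  by rewrite max_steps_nf // reducible_nf // subr0.
by rewrite (reducible_step (step'_step s)) lerBlDl diamond_max_steps_le.
Qed.

Lemma max_steps_le_edl mus n :
  lifting_sequence step' mus ->
  ((expect (mus 0%N) (max_steps step n))%:E <= edl step' mus)%E.
Proof.
move=> lift; rewrite edlE.
apply: (@nneseries_ge_series_term _ _ _ _ n%:R) => [k|N].
  exact: live_prob_ge0.
apply: le_trans (max_steps_le_series_live_prob n N lift) _.
rewrite lerD2l -live_prob_eq live_probE -expectZ.
by apply: le_expect => a _; exact: max_steps_le_reducible.
Qed.

Lemma diamond_edh_eq a : edh step a = edh step' a.
Proof.
apply/eqP; rewrite eq_le edh_sub andbT; apply: edh_le (edh_ge0 _ _) _.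
move=> mus [mus0 lift]; have [mus' [mus'0 lift']] := derivation_exists step' a.
apply: (@le_trans _ _ (edl step' mus')); last exact: edl_le_edh.
rewrite [leLHS]edlE; apply: nneseries_le => [k|n]; first exact: live_prob_ge0.
apply: le_trans (max_steps_le_edl n lift'); rewrite lee_fin mus'0 -mus0.
exact: series_live_prob_le_max_steps.
Qed.

End Diamond.

(** * Positions and substitutions *)

Section Positions.
Variables (S : signature) (V : Type).
Implicit Types (t u v w : term S V) (p q : seq nat).

Lemma App_inj (f : S) (args args' : 'I_(arity f) -> term S V) :
  App f args = App f args' -> args = args'.
Proof. by case=> /(@eq_from_Tagged S (fun f => 'I_(arity f) -> term S V)). Qed.

Definition parallel p q : bool := ~~ prefix p q && ~~ prefix q p.

Lemma subterm_at_nil t : subterm_at t [::] = Some t.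
Proof. by case: t. Qed.

Lemma replace_at_nil t u : replace_at t [::] u = u.
Proof. by case: t. Qed.

Lemma subterm_at_cat t p q :
  subterm_at t (p ++ q) = obind (fun u => subterm_at u q) (subterm_at t p).
Proof. by elim: p t => [|i p IH] [x|f args] //=; case: insub. Qed.

Lemma leq_term_size_subterm_at t p u :
  subterm_at t p = Some u -> (size p + term_size u <= term_size t)%N.
Proof.
elim: p t => [|i p IH] [x|f args] //=; try by case=> <-.
case: insubP => // j _ _ /IH; rewrite (bigD1 j) //=.
by move=> size_le; rewrite addSn ltnS (leq_trans size_le) ?leq_addr.
Qed.

Lemma ltn_term_size_proper_subterm t u :
  proper_subterm u t -> (term_size u < term_size t)%N.
Proof. by case=> -[|i p] // _ /leq_term_size_subterm_at /=; lia. Qed.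

Lemma subterm_replace_at t p u v :
  subterm_at t p = Some u -> subterm_at (replace_at t p v) p = Some v.
Proof.
elim: p t => [|i p IH] [x|f args] //=; rewrite ?subterm_at_nil //.
by case: insubP => // j _ <- /IH; rewrite eqxx.
Qed.

Lemma replace_replace_at t p u v :
  replace_at (replace_at t p u) p v = replace_at t p v.
Proof.
elim: p t => [|i p IH] [x|f args] //=; rewrite ?replace_at_nil //.
by congr App; apply/funext => k; case: eqP => // _; exact: IH.
Qed.

Lemma replace_at_cat t p q u v : subterm_at t p = Some u ->
  replace_at t (p ++ q) v = replace_at t p (replace_at u q v).
Proof.
elim: p t => [|i p IH] [x|f args] //=; try by case=> <-.
case: insubP => // j _ <- tj; congr App; apply/funext => k.
by case: eqP => // /val_inj ->; exact: IH.
Qed.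

Lemma subterm_at_replace_parallel t p q v : parallel p q ->
  subterm_at (replace_at t p v) q = subterm_at t q.
Proof.
elim: p q t => [|i p IH] [|j q] [x|f args] //.
all: rewrite /parallel /= ?prefix0s //.
by case: insubP => // k _ <-; case: eqVneq => [_|//]; exact: IH.
Qed.

Lemma replace_atC t p q u v : parallel p q ->
  replace_at (replace_at t p u) q v = replace_at (replace_at t q v) p u.
Proof.
elim: p q t => [|i p IH] [|j q] [x|f args] //.
all: rewrite /parallel /= ?prefix0s //.
move=> pq; congr App; apply/funext => k.
case: (eqVneq (k : nat) i) pq => [<-|_]; case: (eqVneq (k : nat) j) => // _.
exact: IH.
Qed.

End Positions.

Section Substitutions.
Variables (S : signature) (V : eqType).
Implicit Types (t u v : term S V) (s : V -> term S V) (p q : seq nat).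

Lemma vars_arg (f : S) (args : 'I_(arity f) -> term S V) i :
  vars (args i) `<=` vars (App f args).
Proof. by move=> x xi; rewrite /vars /= (bigD1 i) //= ltn_addr. Qed.

Lemma vars_App (f : S) (args : 'I_(arity f) -> term S V) x :
  vars (App f args) x -> exists i, vars (args i) x.
Proof.
rewrite /vars /= lt0n sum_nat_eq0 => /forallPn[i]; rewrite -lt0n => xi.
by exists i.
Qed.

Lemma linear_term_arg (f : S) (args : 'I_(arity f) -> term S V) i :
  linear_term (App f args) -> linear_term (args i).
Proof.
by move=> lin x; apply: leq_trans (lin x); rewrite /= (bigD1 i) //= leq_addr.
Qed.

Lemma linear_term_arg_inj (f : S) (args : 'I_(arity f) -> term S V) i j x :
  linear_term (App f args) -> vars (args i) x -> vars (args j) x -> i = j.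
Proof.
rewrite /vars /= => /(_ x) /= lin xi xj; apply/eqP; apply: contraTT lin => ij.
by rewrite (bigD1 i) //= (bigD1 j) 1?eq_sym //= -ltnNge; lia.
Qed.

Lemma vars_subterm_at t p x : subterm_at t p = Some (Var x) -> vars t x.
Proof.
elim: p t => [|i p IH] [y|f args] //=.
  by case=> ->; rewrite /vars /= eqxx.
by case: insubP => // j _ _ /IH; exact: vars_arg.
Qed.

Lemma subterm_at_vars t x : vars t x -> exists p, subterm_at t p = Some (Var x).
Proof.
elim: t => [y|f args IH].
  by rewrite /vars /=; case: eqP => // -> _; exists [::].
by case/vars_App => i /IH[p tp]; exists (val i :: p); rewrite /= valK.
Qed.

Lemma eq_subst s s' t :
  (forall x, vars t x -> s x = s' x) -> subst s t = subst s' t.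
Proof.
elim: t => [x|f args IH] ss' /=; first by apply: ss'; rewrite /vars /= eqxx.
congr App; apply/funext => i; apply: IH => x xi.
exact/ss'/vars_arg/xi.
Qed.

Lemma subst_inj s s' t :
  subst s t = subst s' t -> forall x, vars t x -> s x = s' x.
Proof.
elim: t => [y|f args IH] /= e x; first by rewrite /vars /=; case: eqP => // ->.
by case/vars_App => i; apply: IH; rewrite (congr1 (@^~ i) (App_inj e)).
Qed.

Lemma subst_comp (W X : Type) (s : V -> term S W) (s' : W -> term S X) t :
  subst s' (subst s t) = subst (subst s' \o s) t.
Proof.
by elim: t => //= f args IH; congr App; apply/funext => i; exact: IH.
Qed.

Lemma subterm_at_subst s t p u :
  subterm_at t p = Some u -> subterm_at (subst s t) p = Some (subst s u).
Proof.
elim: p t => [|i p IH] [x|f args] //=; rewrite ?subterm_at_nil.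
- by case=> <-.
- by case=> <-.
by case: insubP => // j _ _ /IH.
Qed.

Lemma subterm_at_substP s t p u : subterm_at (subst s t) p = Some u ->
  (exists2 w, subterm_at t p = Some w & ~~ is_var w) \/
  exists x q q', [/\ p = q ++ q', subterm_at t q = Some (Var x) &
                     subterm_at (s x) q' = Some u].
Proof.
elim: t p => [x|f args IH] p /=; first by right; exists x, [::], p.
case: p => [|i p] /=; first by left; exists (App f args).
case: insubP => // j _ <- /IH[[w tw nw]|[x [q [q' [-> tq sq']]]]].
  by left; exists w.
by right; exists x, (val j :: q), q'; rewrite /= valK.
Qed.

Lemma subst_with_notin s x v t :
  ~ vars t x -> subst [eta s with x |-> v] t = subst s t.
Proof.
move=> xt; apply: eq_subst => y yt /=.
by case: eqP => // yx; case: xt; rewrite -yx.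
Qed.

Lemma subst_with_linear s x v t p :
  linear_term t -> subterm_at t p = Some (Var x) ->
  subst [eta s with x |-> v] t = replace_at (subst s t) p v.
Proof.
elim: p t => [|i p IH] [y|f args] //=.
  by move=> _ [->]; rewrite eqxx replace_at_nil.
case: insubP => // j _ <- lin tj; congr App; apply/funext => k.
case: eqP => [/val_inj ->|kj].
  by apply: IH => //; exact: linear_term_arg lin.
apply: subst_with_notin => xk; apply: kj; congr val.
exact: linear_term_arg_inj lin xk (vars_subterm_at tj).
Qed.

Lemma replace_at_subst_linear s x v t p q :
  linear_term t -> subterm_at t p = Some (Var x) ->
  replace_at (subst s t) (p ++ q) v =
  subst [eta s with x |-> replace_at (s x) q v] t.
Proof.
move=> lin tx; rewrite (replace_at_cat _ _ (subterm_at_subst s tx)).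
by rewrite (subst_with_linear _ _ lin tx).
Qed.

End Substitutions.

(** * Redexes *)

Section Redexes.
Variables (R : realType) (S : signature) (V : countType) (P : ptrs R S V).
Implicit Types (t u v w : term S V) (r : rule R S V) (s : V -> term S V).
Implicit Types (p q : seq nat) (mu nu : fdist R (term S V)).

Definition redex_at u p r s : Prop :=
  rules P r /\ subterm_at u p = Some (subst s (lhs r)).

Definition contractum u p r s : fdist R (term S V) :=
  fdist_map (fun t => replace_at u p (subst s t)) (rhs r).

Definition innermost_instance r s : Prop :=
  forall w, proper_subterm w (subst s (lhs r)) -> normal_form (full_step P) w.

Lemma contractsP u p r s mu :
  rules P r /\ contracts u p r s mu <->
  redex_at u p r s /\ mu = contractum u p r s.
Proof.
by split=> [[Pr [up muE]]|[[Pr up] ->]]; split=> //; exact: fdist_inj.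
Qed.

Lemma full_stepP u mu : full_step P u mu <->
  exists p r s, redex_at u p r s /\ mu = contractum u p r s.
Proof. by split=> -[p [r [s /contractsP h]]]; exists p, r, s. Qed.

Lemma innermost_stepP u mu : innermost_step P u mu <->
  exists p r s, [/\ redex_at u p r s, innermost_instance r s &
                    mu = contractum u p r s].
Proof.
split=> [[p [r [s [Pr c inn]]]]|[p [r [s [red inn ->]]]]]; exists p, r, s.
  by have /contractsP[red ->] := conj Pr c.
by have /contractsP[Pr c] := conj red (erefl (contractum u p r s)).
Qed.

Lemma innermost_full_step u mu : innermost_step P u mu -> full_step P u mu.
Proof. by case=> p [r [s [Pr c _]]]; exists p, r, s. Qed.

Lemma redex_at_full_step u p r s :
  redex_at u p r s -> full_step P u (contractum u p r s).
Proof. by move=> red; apply/full_stepP; exists p, r, s. Qed.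

Lemma redex_at_innermost_step u p r s :
  redex_at u p r s -> innermost_instance r s ->
  innermost_step P u (contractum u p r s).
Proof. by move=> red inn; apply/innermost_stepP; exists p, r, s. Qed.

Lemma redex_at_cat u p w q r s :
  subterm_at u p = Some w -> redex_at w q r s -> redex_at u (p ++ q) r s.
Proof. by move=> uw [Pr wq]; split; rewrite // subterm_at_cat uw. Qed.

Lemma redex_at_replace u p w r s :
  rules P r -> subterm_at u p = Some w ->
  redex_at (replace_at u p (subst s (lhs r))) p r s.
Proof. by move=> Pr uw; split=> //; exact: subterm_replace_at uw. Qed.

Lemma normal_form_innermost u :
  normal_form (innermost_step P) u -> normal_form (full_step P) u.
Proof.
have [n] := ubnP (term_size u); elim: n u => // n IH u; rewrite ltnS => size_u.
move=> nf [mu /full_stepP[p [r [s [red _]]]]].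
have [inn|] := pselect (innermost_instance r s).
  by apply: nf; exists (contractum u p r s); exact: redex_at_innermost_step.
move=> /existsNP[w /not_implyP[lw]]; apply.
apply: IH => [|[nu /innermost_stepP]].
  apply: leq_trans (ltn_term_size_proper_subterm lw) (leq_trans _ size_u).
  by have [_ /leq_term_size_subterm_at] := red; lia.
move=> [p' [r' [s' [red' inn' _]]]]; apply: nf; case: lw => q _ lq.
exists (contractum u ((p ++ q) ++ p') r' s').
apply: redex_at_innermost_step => //.
by apply: redex_at_cat red'; rewrite subterm_at_cat red.2.
Qed.

Lemma overlap_instance r r' p w s s' :
  subterm_at (lhs r) p = Some w -> ~~ is_var w -> (r = r' -> p <> [::]) ->
  subst s w = subst s' (lhs r') -> overlap r r' p.
Proof.
move=> lw nw rp e; exists w; split=> //.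
pose sigma z := rename (inl : V -> V + V)
  (match z with inl x => s x | inr x => s' x end).
exists sigma; transitivity (rename (inl : V -> V + V) (subst s w)).
  by rewrite /rename !subst_comp.
by rewrite e /rename !subst_comp.
Qed.

Lemma non_overlapping_subterm r s q r' s' : non_overlapping P ->
  rules P r -> rules P r' ->
  subterm_at (subst s (lhs r)) q = Some (subst s' (lhs r')) ->
  (q = [::] /\ r = r') \/
  exists x q1 q2, [/\ q = q1 ++ q2, subterm_at (lhs r) q1 = Some (Var x) &
                      subterm_at (s x) q2 = Some (subst s' (lhs r'))].
Proof.
move=> nonovP Pr Pr' lq.
have [[w lw nw]|] := subterm_at_substP lq; last by right.
left; apply: contrapT => not_same; apply: (nonovP r r' q Pr Pr').
apply: (overlap_instance (s := s) (s' := s') lw nw) => [rr' q0|].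
  exact: not_same.
by move: lq; rewrite (subterm_at_subst s lw) => -[].
Qed.

Lemma eq_contractum u p r s s' : rules P r ->
  subst s (lhs r) = subst s' (lhs r) ->
  contractum u p r s = contractum u p r s'.
Proof.
move=> Pr e; apply: eq_fdist_map => t /(rules_vars Pr) tl; congr replace_at.
by apply: eq_subst => x /tl; exact: subst_inj e x.
Qed.

Local Notation joinable := (joinable (full_step P) (innermost_step P)).

Lemma joinable_parallel u p r s p' r' s' :
  parallel p p' -> redex_at u p r s -> redex_at u p' r' s' ->
  innermost_instance r' s' ->
  joinable (contractum u p r s) (contractum u p' r' s').
Proof.
move=> pp' [Pr up] [Pr' up'] inn'.
apply: (joinable_grid (h := fun t t' =>
  replace_at (replace_at u p (subst s t)) p' (subst s' t'))) => [t|t'] _.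
  left; apply: redex_at_innermost_step => //; split=> //.
  by rewrite subterm_at_replace_parallel.
under eq_fun do rewrite replace_atC //.
apply: redex_at_full_step; split=> //.
by rewrite subterm_at_replace_parallel // /parallel andbC.
Qed.

Hypotheses (llinP : left_linear P) (rlinP : right_linear P).

Lemma joinable_inside_subst u p r s x q1 q2 r' s' :
  redex_at u p r s -> rules P r' -> innermost_instance r' s' ->
  subterm_at (lhs r) q1 = Some (Var x) ->
  subterm_at (s x) q2 = Some (subst s' (lhs r')) ->
  joinable (contractum u p r s) (contractum u (p ++ q1 ++ q2) r' s').
Proof.
move=> [Pr up] Pr' inn' lx sx.
pose s_inner t' := [eta s with x |-> replace_at (s x) q2 (subst s' t')].
apply: (joinable_grid (h := fun t t' => replace_at u p (subst (s_inner t') t))).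
- move=> t tr; have [xt|xt] := pselect (vars t x); last first.
    by right=> t'; rewrite /s_inner subst_with_notin.
  left; have [q tq] := subterm_at_vars xt.
  have ut := subterm_replace_at (subst s t) up.
  rewrite (_ : fdist_map _ _ =
    contractum (replace_at u p (subst s t)) (p ++ q ++ q2) r' s').
    apply: redex_at_innermost_step => //; split=> //.
    by rewrite subterm_at_cat ut /= subterm_at_cat (subterm_at_subst s tq).
  apply: eq_fdist_map => t' _; rewrite (replace_at_cat _ _ ut).
  rewrite replace_replace_at.
  by rewrite (replace_at_subst_linear _ _ _ (rlinP Pr tr) tq).
- move=> t' _; rewrite (replace_at_cat _ _ up).
  rewrite (replace_at_subst_linear _ _ _ (llinP Pr) lx) -/(s_inner t').
  under eq_fun do
    rewrite -(replace_replace_at u p (subst (s_inner t') (lhs r))).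
  exact/redex_at_full_step/(redex_at_replace _ Pr up).
Qed.

Lemma full_innermost_diamond :
  non_overlapping P -> diamond (full_step P) (innermost_step P).
Proof.
move=> nonovP u mu nu /full_stepP[p [r [s [red ->]]]].
move=> /innermost_stepP[p' [r' [s' [red' inn' ->]]]].
have [Pr up] := red; have [Pr' up'] := red'.
have [/prefixP[q p'E]|np] := boolP (prefix p p').
  move: up'; rewrite {}p'E subterm_at_cat up /= => lq.
  have [[q0 rr']|] := non_overlapping_subterm nonovP Pr Pr' lq.
    move: lq; rewrite q0 -rr' cats0 subterm_at_nil => -[e].
    by rewrite (eq_contractum u p Pr e); exact: joinable_refl.
  by move=> [x [q1 [q2 [-> lx sx]]]]; exact: joinable_inside_subst lx sx.
have [/prefixP[q pE]|np'] := boolP (prefix p' p); last first.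
  by apply: joinable_parallel => //; rewrite /parallel np np'.
have lq : subterm_at (subst s' (lhs r')) q = Some (subst s (lhs r)).
  by rewrite -up pE subterm_at_cat up'.
have [|] := inn' (subst s (lhs r)).
  by exists q => // q0; rewrite pE q0 cats0 prefix_refl in np.
exists (contractum (subst s (lhs r)) [::] r s); apply: redex_at_full_step.
by split; rewrite ?subterm_at_nil.
Qed.

End Redexes.

Theorem theorem4p6 (R : realType) (S : signature) (V : countType) (P : ptrs R S V)
    (orthoP : orthogonal_ptrs P) (rlinP : right_linear P) :
  edc (full_step P) = edc (innermost_step P) /\
  erc P (full_step P) = erc P (innermost_step P).
Proof.
have [nonovP llinP] := orthoP.
suff e : edh (full_step P) = edh (innermost_step P) by rewrite /edc /erc e.
apply/funext => t; apply: diamond_edh_eq.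
- exact: innermost_full_step.
- exact: normal_form_innermost.
- exact: full_innermost_diamond.
Qed.
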